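(* Let $k$ be a nonnegative integer. If $\pi\in\mathcal{C}_3$ is a permutation gate on $n$ qubits such that some coordinate of the polynomial representation of $\pi$ contains a monomial of degree $k$, then $n\ge2^k-1$. Moreover, this bound is sharp for all $k\ge3$: for every integer $k\geq 3$ there is a permutation gate in $\mathcal{C}_3$ on exactly $2^k-1$ qubits whose polynomial representation contains a monomial of degree $k$.
   Context: Gates on $n$ qubits are unitary operators on $(\mathbb{C}^2)^{\otimes n}$, with computational basis $\{|v\rangle : v\in\mathbb{F}_2^n\}$. The Pauli group $\mathcal{P}_n$ consists of all $cP_1\otimes\cdots\otimes P_n$ with $c\in\{\pm1,\pm i\}$ and $P_j\in\{I_2,X,Y,Z\}$. The Clifford hierarchy: $\mathcal{C}_1=\mathcal{P}_n$, and for $m\ge2$, $\mathcal{C}_m$ is the set of unitaries $U$ with $UPU^\dagger\in\mathcal{C}_{m-1}$ for all $P\in\mathcal{P}_n$. A permutation gate is a unitary whose matrix in the computational basis is a permutation matrix; it is identified with the bijection $\pi:\mathbb{F}_2^n\to\mathbb{F}_2^n$ with $\pi|a\rangle=|\pi(a)\rangle$. Every function $\mathbb{F}_2^n\to\mathbb{F}_2$ is uniquely a polynomial over $\mathbb{F}_2$ in $a_1,\dots,a_n$ of degree at most $1$ in each variable. Writing $\pi(a)=(\pi_1(a),\dots,\pi_n(a))$ with each $\pi_i$ such a polynomial, $(\pi_1,\dots,\pi_n)$ is the polynomial representation of $\pi$, and $\pi_i$ is its $i$-th coordinate. *)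

(* Defs.v *)
From HB Require Import structures.
From mathcomp Require Import all_boot all_order all_algebra all_fingroup.
From mathcomp Require Import sesquilinear spectral.
From mathcomp Require Import reals complex mpoly.

Set Implicit Arguments.
Unset Strict Implicit.
Unset Printing Implicit Defensive.

Import Order.TTheory GRing.Theory Num.Theory.
Local Open Scope ring_scope.
Local Open Scope sesquilinear_scope.

Notation bits n := 'rV['F_2]_n.

(* Operators on (C^2)^{(x) n}: row and column r stand for the basis vector
   |label r>, so that the computational basis is indexed by F_2^n. *)
Notation operator R n := 'M[R[i]]_(#|{: bits n}|).

Section Gates.

Variables (R : realType) (n : nat).

Definition label (r : 'I_#|{: bits n}|) : bits n := enum_val r.

Definition ket (v : bits n) : 'cV[R[i]]_(#|{: bits n}|) :=
  delta_mx (enum_rank v) 0.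

(* The Kronecker product P 0 (x) ... (x) P n.-1. 'F_2 is convertible to 'I_2,
   so bits directly index the entries of the factors. *)
Definition tensor (P : 'I_n -> 'M[R[i]]_2) : operator R n :=
  \matrix_(r, s) \prod_(j < n) P j (label r 0 j) (label s 0 j).

Definition pauliX : 'M[R[i]]_2 := \matrix_(a, b) (a != b)%:R.

Definition pauliY : 'M[R[i]]_2 :=
  \matrix_(a, b) if a == b then 0 else if a == 0 then - 'i else 'i.

Definition pauliZ : 'M[R[i]]_2 :=
  \matrix_(a, b) if a == b then (-1) ^+ a else 0.

Definition pauli_group (U : operator R n) : Prop :=
  exists2 c : R[i], c \in [:: 1; -1; 'i; - 'i] &
  exists2 P : 'I_n -> 'M[R[i]]_2,
    (forall j, P j \in [:: 1%:M; pauliX; pauliY; pauliZ]) & U = c *: tensor P.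

(* The levels are numbered from 1; level 0 is a dummy. *)
Fixpoint clifford_hierarchy (m : nat) (U : operator R n) : Prop :=
  match m with
  | 0 => False
  | 1 => pauli_group U
  | m'.+1 => U \is unitarymx /\
      (forall P, pauli_group P -> clifford_hierarchy m' (U *m P *m U^t*))
  end.

Definition perm_gate (pi : {perm bits n}) : operator R n :=
  \matrix_(r, s) (label r == pi (label s))%:R.

Lemma perm_gate_ket (pi : {perm bits n}) (a : bits n) :
  perm_gate pi *m ket a = ket (pi a).
Proof.
rewrite /ket -colE; apply/colP => r.
rewrite !mxE /label enum_rankK eqxx andbT.
by rewrite -(inj_eq enum_rank_inj) enum_valK.
Qed.

End Gates.

Section PolynomialRepresentation.

Variable n : nat.

Definition reduced (p : {mpoly 'F_2[n]}) : Prop :=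
  forall m, m \in msupp p -> forall j, (m j <= 1)%N.

Definition polynomial_representation
    (pi : bits n -> bits n) (p : 'I_n -> {mpoly 'F_2[n]}) : Prop :=
  forall i, reduced (p i) /\ forall a : bits n, (p i).@[a 0] = pi a 0 i.

Definition has_monomial_of_degree (pi : bits n -> bits n) (k : nat) : Prop :=
  exists2 p, polynomial_representation pi p &
  exists i, exists2 m, m \in msupp (p i) & mdeg m = k.

End PolynomialRepresentation.

(* Main.v *)
(* If pi is in the third level, every map x |-> pi (pi^-1 x + v) is affine, so
   there are additive N_v and constants c_v with
   pi (x + v) + pi x = N_v (pi x) + c_v.  The coefficient vector d_T of the
   monomial T in pi is the iterated difference of pi at 0 along T; hence, for
   T nonempty, N_j d_T is d_(T + j), or 0 when j is in T.  If d_T != 0, applying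
   N_j for all j in T \ T0 to a linear relation among the d_S, with S nonempty
   inside T and T0 of minimal size in the relation, leaves only a multiple of
   d_T.  So these 2^|T| - 1 vectors of F_2^n are linearly independent.

   For sharpness, take A = F_2[x_1, ..., x_k] / (x_1^2, ..., x_k^2), whose
   elements with constant coefficient 1 form an elementary abelian group G with
   2^k - 1 non-constant coordinates.  Let pi^-1 : G -> F_2^(2^k - 1) collect, for
   each nonempty S and a chosen s in S, the coefficient of x_(S \ s) in
   u^-1 * (d u / d x_s) = u * (d u / d x_s).  It is a quadratic isomorphism from
   G to an additive group, so pi turns translations into multiplications in A,
   which are affine; and pi has a monomial of degree k, as the iterated
   difference of pi along the basis vectors of the singletons is
   x_1 * ... * x_k. *)
Require Import Defs.
From HB Require Import structures.
From mathcomp Require Import all_boot all_order all_algebra all_fingroup.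
From mathcomp Require Import sesquilinear spectral.
From mathcomp Require Import reals complex mpoly ring.

Set Implicit Arguments.
Unset Strict Implicit.
Unset Printing Implicit Defensive.

(** * Monomial operators and the Clifford hierarchy *)

Section CharacteristicTwo.
Import GRing.Theory.
Local Open Scope ring_scope.

(** In characteristic two this is preservation of affine combinations. No linear part or constant
    has to be named, so the property passes easily to inverses and composites. *)
Definition affine (U V : zmodType) (f : U -> V) : Prop :=
  forall x y z, f (x + y + z) = f x + f y + f z.

Lemma F2_addrr (x : 'F_2) : x + x = 0.
Proof. by rewrite addrr_pchar2 // pchar_Fp. Qed.

Lemma F2_neq0 (x : 'F_2) : x != 0 -> x = 1.
Proof. by case: x => [[|[|//]] ?] // _; apply: val_inj. Qed.

Lemma bits_addrr n (x : bits n) : x + x = 0.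
Proof. by apply/rowP=> j; rewrite !mxE F2_addrr. Qed.

Lemma bits_addrK n (x y : bits n) : x + y + y = x.
Proof. by rewrite -addrA bits_addrr addr0. Qed.

Lemma affineD (U V : zmodType) (f : U -> V) (x y : U) :
  affine f -> (forall u : V, u + u = 0) -> f (x + y) = f x + f y + f 0.
Proof. by move=> f_aff V2; rewrite -{1}[x + y]addr0 f_aff. Qed.

Lemma affine_form n (q : bits n -> 'F_2) : affine q ->
  exists w : bits n, forall s, q s = q 0 + \sum_j w 0 j * s 0 j.
Proof.
move=> q_aff; exists (\row_j (q (delta_mx 0 j) + q 0)) => s.
have q_add x y : q (x + y) + q 0 = (q x + q 0) + (q y + q 0).
  by rewrite (affineD _ _ q_aff F2_addrr) -addrA F2_addrr addr0 addrACA F2_addrr addr0.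
have -> : \sum_j (\row_j (q (delta_mx 0 j) + q 0)) 0 j * s 0 j
        = \sum_j (q (s 0 j *: delta_mx 0 j) + q 0).
  apply: eq_bigr => j _; rewrite mxE; have [->|/F2_neq0 ->] := eqVneq (s 0 j) 0.
    by rewrite scale0r mulr0 F2_addrr.
  by rewrite scale1r mulr1.
(* The map [x |-> q x + q 0] is additive, so it commutes with the expansion of [s] in the standard
   basis. *)
rewrite -(big_morph (fun x => q x + q 0) q_add (F2_addrr _)) -row_sum_delta.
by rewrite addrCA F2_addrr addr0.
Qed.

End CharacteristicTwo.

(** * Basis permutations with signs, Pauli operators, and the second and third levels *)

Section MonomialOperators.
Import Order.TTheory GRing.Theory Num.Theory.
Local Open Scope ring_scope.
Local Open Scope sesquilinear_scope.

Variables (R : realType) (n : nat).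

Definition sgn (x : 'F_2) : R[i] := (-1) ^+ x.

Lemma sgnD x y : sgn (x + y) = sgn x * sgn y.
Proof.
by rewrite /sgn -exprD -signr_odd -[RHS]signr_odd /= modn2 oddb.
Qed.

Lemma sgn_sum (F : 'I_n -> 'F_2) : sgn (\sum_j F j) = \prod_j sgn (F j).
Proof. by rewrite (big_morph sgn sgnD (erefl _)). Qed.

Lemma conj_sgn x : (sgn x)^* = sgn x.
Proof. by rewrite /sgn rmorphXn rmorphN rmorph1. Qed.

Lemma sgnK x : sgn x * sgn x = 1.
Proof. by rewrite -sgnD F2_addrr. Qed.

(** The operator sending [|s>] to [c (-1)^(q s) |t s>]. Permutation gates and Pauli operators both
    have this form, and it is stable under product and adjoint, so every conjugation reduces to
    computing with [c], [t] and [q]. *)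
Definition monomial_operator (c : R[i]) (t : {perm bits n})
    (q : bits n -> 'F_2) : operator R n :=
  \matrix_(r, s) (c * sgn (q (label s)) * (label r == t (label s))%:R).

Lemma eq_monomial_operator c t q q' :
  q =1 q' -> monomial_operator c t q = monomial_operator c t q'.
Proof. by move=> qq'; apply/matrixP => r s; rewrite !mxE qq'. Qed.

Lemma monomial_operatorM c c' t t' q q' :
  monomial_operator c t q *m monomial_operator c' t' q' =
  monomial_operator (c * c') (t' * t) (fun s => q' s + q (t' s)).
Proof.
apply/matrixP => r s; rewrite !mxE (bigD1 (enum_rank (t' (label s)))) //=.
rewrite big1 ?addr0 => [|r' ne_r']; last first.
  rewrite !mxE; have [e|] := eqVneq (label r') _; last by rewrite !mulr0.
  by rewrite -e /label enum_valK eqxx in ne_r'.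
by rewrite !mxE /label enum_rankK eqxx permM sgnD /= mulr1n mulr1; ring.
Qed.

Lemma monomial_operator_adjoint c t q :
  (monomial_operator c t q)^t* =
  monomial_operator c^* t^-1 (fun s => q (t^-1%g s)).
Proof.
apply/matrixP => r s; rewrite !mxE !rmorphM rmorph_nat /= conj_sgn.
rewrite [label s == _]eq_sym (can2_eq (permK t) (permKV t)).
by case: eqP => [->|_]; rewrite ?permK // !mulr0.
Qed.

Lemma perm_gateE (pi : {perm bits n}) : perm_gate R pi = monomial_operator 1 pi (fun=> 0).
Proof. by apply/matrixP => r s; rewrite !mxE /sgn expr0 !mul1r. Qed.

Lemma monomial_operator_unitary c t q :
  c * c^* = 1 -> monomial_operator c t q \is unitarymx.
Proof.
move=> cc; apply/unitarymxP; rewrite monomial_operator_adjoint monomial_operatorM cc.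
rewrite mulVg; apply/matrixP => r s; rewrite !mxE perm1 sgnD sgnK !mul1r.
by rewrite /label (inj_eq enum_val_inj).
Qed.

Lemma perm_gate_unitary (pi : {perm bits n}) : perm_gate R pi \is unitarymx.
Proof. by rewrite perm_gateE monomial_operator_unitary // rmorph1 mulr1. Qed.

Lemma translation_inj (v : bits n) : injective (+%R^~ v).
Proof. exact: addIr. Qed.

Definition translation (v : bits n) : {perm bits n} := perm (@translation_inj v).

Lemma translationE v x : translation v x = x + v.
Proof. exact: permE. Qed.

(** The four phases are the roots of [c^4 - 1 = (c - 1)(c + 1)(c - i)(c + i)]; as an equation,
    membership is visibly stable under products. *)
Lemma phaseP (c : R[i]) : reflect (c ^+ 4 = 1) (c \in [:: 1; -1; 'i; - 'i]).
Proof.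
have -> : (c \in [:: 1; -1; 'i; - 'i]) = (c ^+ 4 - 1 == 0).
  have -> : c ^+ 4 - 1 = (c - 1) * (c + 1) * ((c - 'i) * (c + 'i)).
    have -> : (c - 'i) * (c + 'i) = c ^+ 2 - 'i ^+ 2 by ring.
    by rewrite sqrCi; ring.
  by rewrite !mulf_eq0 !inE !subr_eq0 !addr_eq0 orbA.
by rewrite subr_eq0; apply: eqP.
Qed.

Lemma phase_norm (c : R[i]) : c ^+ 4 = 1 -> c * c^* = 1.
Proof.
have ii : 'i * 'i = -1 :> R[i] by rewrite -expr2 sqrCi.
move=> /phaseP; rewrite !inE => /or4P[] /eqP ->;
  by rewrite ?rmorphN ?rmorph1 /= ?conjCi ?mulrN ?mulNr ?opprK ?ii ?opprK ?mulr1.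
Qed.

(** Each factor is a phase times [X^a Z^b], with [Y = i X Z]. The triple [z] holds the phase, the
    shift and the sign exponent, packed together so that one choice serves all qubits. *)
Lemma pauli_matrixP (M : 'M[R[i]]_2) :
  M \in [:: 1%:M; pauliX R; pauliY R; pauliZ R] ->
  exists z : R[i] * 'F_2 * 'F_2, z.1.1 ^+ 4 = 1 /\
    forall a b : 'F_2, M a b = z.1.1 * sgn (z.2 * b) * (a == b + z.1.2)%:R.
Proof.
have i4 : 'i ^+ 4 = 1 :> R[i] by apply/phaseP; rewrite !inE eqxx !orbT.
rewrite !inE => /or4P[] /eqP ->.
- exists (1, 0, 0); split; rewrite /= ?expr1n // => a b.
  by rewrite !mxE mul0r addr0 /sgn expr0 !mul1r.
- exists (1, 1, 0); split; rewrite /= ?expr1n // => a b.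
  rewrite !mxE mul0r /sgn expr0 !mul1r.
  by case: a b => [[|[|//]] ?] [[|[|//]] ?].
- exists ('i, 1, 1); split; rewrite //= => a b.
  rewrite !mxE mul1r /sgn.
  by case: a b => [[|[|//]] ?] [[|[|//]] ?]; rewrite /= ?expr1 ?expr0 ?mulr0 ?mulr1 // mulrN1.
- exists (1, 0, 1); split; rewrite /= ?expr1n // => a b.
  rewrite !mxE mul1r /sgn addr0 mul1r.
  case: eqP => [->|_]; by rewrite ?mulr1 ?mulr0.
Qed.

Lemma pauli_matrix_of (v w : 'F_2) :
  exists z : R[i] * 'M[R[i]]_2, [/\ z.1 ^+ 4 = 1,
    z.2 \in [:: 1%:M; pauliX R; pauliY R; pauliZ R] &
    forall a b : 'F_2, sgn (w * b) * (a == b + v)%:R = z.1 * z.2 a b].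
Proof.
have ni4 : (- 'i) ^+ 4 = 1 :> R[i] by apply/phaseP; rewrite !inE eqxx !orbT.
have ii : 'i * 'i = -1 :> R[i] by rewrite -expr2 sqrCi.
have [->|/F2_neq0 ->] := eqVneq v 0; have [->|/F2_neq0 ->] := eqVneq w 0.
- exists (1, 1%:M); split; rewrite /= ?inE ?expr1n ?eqxx ?orbT // => a b.
  by rewrite !mxE mul0r addr0.
- exists (1, pauliZ R); split; rewrite /= ?inE ?expr1n ?eqxx ?orbT // => a b.
  rewrite !mxE !mul1r addr0; case: eqP => [->|_]; by rewrite ?mulr1 ?mulr0.
- exists (1, pauliX R); split; rewrite /= ?inE ?expr1n ?eqxx ?orbT // => a b.
  rewrite !mxE mul0r /sgn expr0 !mul1r.
  by case: a b => [[|[|//]] ?] [[|[|//]] ?].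
- exists (- 'i, pauliY R); split; rewrite /= ?inE ?eqxx ?orbT // => a b.
  rewrite !mxE mul1r /sgn.
  case: a b => [[|[|//]] ?] [[|[|//]] ?];
    by rewrite /= ?expr1 ?expr0 ?mulr0 ?mulr1 // ?mulrNN ?mulNr ?ii ?opprK.
Qed.

Lemma prod_natb (F : 'I_n -> bool) :
  \prod_j (F j)%:R = [forall j, F j]%:R :> R[i].
Proof.
case: forallP => [F1|/forallP]; first by rewrite big1 // => j _; rewrite F1.
rewrite negb_forall => /existsP[j /negPf Fj].
by rewrite (bigD1 j) //= Fj mul0r.
Qed.

Lemma bits_eq_forall (x y : bits n) : [forall j, x 0 j == y 0 j] = (x == y).
Proof.
apply/forallP/eqP => [e|-> //]; apply/rowP => j; exact/eqP.
Qed.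

(** In a tensor product the phases, the signs and the Kronecker deltas of the factors multiply
    separately: they give [c], the character of [w] and the translation by [v]. *)
Lemma pauli_groupP (U : operator R n) : pauli_group U <->
  exists (c : R[i]) (v w : bits n), c ^+ 4 = 1 /\
    U = monomial_operator c (translation v) (fun s => \sum_j w 0 j * s 0 j).
Proof.
split=> [[c /phaseP c4 [P P_pauli ->]]|[c [v [w [c4 ->]]]]].
  have [z /all_and2[z4 zE]] := fin_all_exists (fun j => pauli_matrixP (P_pauli j)).
  exists (c * \prod_j (z j).1.1), (\row_j (z j).1.2), (\row_j (z j).2); split.
    by rewrite exprMn c4 mul1r -prodrXl big1.
  apply/matrixP => r s; rewrite !mxE.
  rewrite (eq_bigr _ (fun j _ => zE j (label r 0 j) (label s 0 j))).
  rewrite !big_split /= prod_natb -!mulrA; congr (_ * (_ * (_ * _))).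
    by rewrite sgn_sum; apply: eq_bigr => j _; rewrite mxE.
  rewrite translationE -bits_eq_forall; congr (nat_of_bool _)%:R.
  by apply: eq_forallb => j; rewrite !mxE.
have [z zP] := fin_all_exists (fun j => pauli_matrix_of (v 0 j) (w 0 j)).
exists (c * \prod_j (z j).1).
  apply/phaseP; rewrite exprMn c4 mul1r -prodrXl big1 // => j _.
  by have [] := zP j.
exists (fun j => (z j).2) => [j|]; first by have [] := zP j.
apply/matrixP => r s; rewrite !mxE -!mulrA -big_split /=; congr (_ * _).
under [RHS]eq_bigr => j _.
  have [_ _ <-] := zP j; over.
rewrite big_split /= prod_natb sgn_sum translationE -bits_eq_forall.
congr (_ * (nat_of_bool _)%:R).
by apply: eq_forallb => j; rewrite !mxE.
Qed.

Lemma pauli_affine_phase c v (q : bits n -> 'F_2) : c ^+ 4 = 1 -> affine q ->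
  pauli_group (monomial_operator c (translation v) q).
Proof.
move=> c4 /affine_form[w wE]; apply/pauli_groupP.
exists (c * sgn (q 0)), v, w; split.
  by rewrite exprMn c4 mul1r (exprM _ 2 2) (expr2 (sgn _)) sgnK expr1n.
by apply/matrixP => r s; rewrite !mxE wE sgnD !mulrA.
Qed.

Lemma pauli_perm_gate (t : {perm bits n}) :
  pauli_group (perm_gate R t) -> exists v, forall x, t x = x + v.
Proof.
move=> /pauli_groupP[c [v [w [c4 /matrixP tE]]]]; exists v => x.
(* The entry in row [t x] and column [x] is 1 on the left, hence nonzero on the right, which forces
   [t x = x + v]. *)
have := tE (enum_rank (t x)) (enum_rank x).
rewrite !mxE /label !enum_rankK eqxx translationE; case: eqP => // _ /eqP.
by rewrite mulr0 oner_eq0.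
Qed.

Lemma pauli_translation v : pauli_group (perm_gate R (translation v)).
Proof.
rewrite perm_gateE; apply: pauli_affine_phase; first exact: expr1n.
by move=> x y z; rewrite !addr0.
Qed.

Lemma perm_gate_conj (s t : {perm bits n}) :
  perm_gate R s *m perm_gate R t *m (perm_gate R s)^t* =
  perm_gate R (s^-1 * t * s).
Proof.
rewrite !perm_gateE monomial_operator_adjoint !monomial_operatorM rmorph1 !mulr1.
by rewrite mulgA; apply: eq_monomial_operator => x; rewrite !addr0.
Qed.

(** Conjugating a translation by [t] gives a permutation gate in the Pauli group, again a
    translation. So the increment of [t] along [v] does not depend on the base point. *)
Lemma clifford_perm_gate_affine (t : {perm bits n}) :
  clifford_hierarchy 2 (perm_gate R t) -> affine t.
Proof.
move=> [_ t_cliff] x y z.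
have tD v : exists w, forall u, t (u + v) = t u + w.
  have := t_cliff _ (pauli_translation v); rewrite perm_gate_conj.
  move=> /pauli_perm_gate[w wE]; exists w => u.
  by rewrite -wE !permM permK translationE.
have [w yE] := tD y; have [w' zE] := tD z.
have -> : t y = t 0 + w by rewrite -yE add0r.
have -> : t z = t 0 + w' by rewrite -zE add0r.
by rewrite zE yE -!addrA; congr (_ + _); rewrite (addrCA w) (addrA (t 0) (t 0)) bits_addrr add0r.
Qed.

Lemma third_level_affine (pi : {perm bits n}) v :
  clifford_hierarchy 3 (perm_gate R pi) ->
  affine (fun x => pi (pi^-1%g x + v)).
Proof.
move=> [_ /(_ _ (pauli_translation v))]; rewrite perm_gate_conj.
move=> /clifford_perm_gate_affine aff x y z.
by have := aff x y z; rewrite !permM !translationE.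
Qed.

(** The first hypothesis makes the permutation part of a conjugated Pauli operator affine; the
    second makes its sign exponent, a linear form in [pi^-1], quadratic. A second conjugation then
    yields a translation with an affine sign exponent, that is, a Pauli operator. *)
Lemma third_level_criterion (pi : {perm bits n}) :
  (forall v, affine (fun x => pi (pi^-1%g x + v))) ->
  (forall v, affine (fun x => pi^-1%g (x + v) + pi^-1%g x)) ->
  clifford_hierarchy 3 (perm_gate R pi).
Proof.
move=> pi_aff pi_quad; split=> [|_ /pauli_groupP[c [v [w [c4 ->]]]]].
  exact: perm_gate_unitary.
rewrite perm_gateE monomial_operator_adjoint !monomial_operatorM rmorph1 mulr1 mul1r.
set t := (_ * (_ * _))%g; set q := fun s => _ + _.
have tE x : t x = pi (pi^-1%g x + v) by rewrite !permM translationE.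
have t_aff : affine t by move=> x y z; rewrite !tE pi_aff.
have qE x : q x = \sum_j w 0 j * pi^-1%g x 0 j by rewrite /q add0r addr0.
have q_quad u : affine (fun x => q (x + u) + q x).
  move=> x y z; rewrite !qE -!big_split /=; apply: eq_bigr => j _.
  have /rowP/(_ j) := pi_quad u x y z; rewrite !mxE -!mulrDr => <- //.
have tV_aff : affine t^-1%g.
  by move=> x y z; apply: (@perm_inj _ t); rewrite t_aff !permKV.
(* From here on only the affinity of [t] and its inverse and the quadratic nature of [q] matter. *)
clearbody t q; clear tE qE.
split=> [|_ /pauli_groupP[c' [v' [w' [c4' ->]]]]].
  by apply: monomial_operator_unitary; apply: phase_norm.
rewrite monomial_operator_adjoint !monomial_operatorM.
set t' := (_ * (_ * _))%g; set q' := fun s => _ + _.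
have -> : t' = translation (t v' + t 0).
  apply/permP => x; rewrite !permM !translationE.
  by rewrite (affineD _ _ t_aff (@bits_addrr n)) permKV addrA.
apply: pauli_affine_phase => [|x y z].
  by rewrite mulrAC phase_norm // mul1r.
rewrite /q' !translationE.
(* The exponent [q] occurs twice, at arguments differing by [v']; grouping the two gives a
   difference of [q], which is affine. *)
have swap a b d : q a + (b + q (a + d)) = b + (q (a + d) + q a).
  by rewrite addrC -!addrA.
rewrite !swap tV_aff q_quad.
have -> : \sum_j w' 0 j * (t^-1%g x + t^-1%g y + t^-1%g z) 0 j =
  \sum_j w' 0 j * t^-1%g x 0 j + \sum_j w' 0 j * t^-1%g y 0 j
  + \sum_j w' 0 j * t^-1%g z 0 j.
  by rewrite -!big_split /=; apply: eq_bigr => j _; rewrite !mxE -!mulrDr.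
by rewrite addrACA; congr (_ + _); rewrite addrACA.
Qed.

End MonomialOperators.

(** * Monomials and the lower bound *)

Section SubsetSums.
Import GRing.Theory.
Local Open Scope ring_scope.

(** The predicate [c] selects one element of each pair [{i, h i}], so [h] has no fixed point in [P]
    and equal terms cancel in characteristic two. *)
Lemma sum_involution (I : finType) (V : zmodType) (P c : pred I) (h : I -> I)
    (F : I -> V) :
    (forall u : V, u + u = 0) -> involutive h ->
    (forall i, P (h i) = P i) -> (forall i, P i -> c (h i) = ~~ c i) ->
    (forall i, P i -> F (h i) = F i) ->
  \sum_(i | P i) F i = 0.
Proof.
move=> V2 hK hP hc hF; rewrite (bigID c) /= addrC (reindex_inj (inv_inj hK)) /=.
rewrite [X in X + _](_ : _ = \sum_(i | P i && c i) F i) ?V2 //.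
apply: eq_big => [i|i /andP[]]; rewrite hP; last by move/hF.
by have [/hc->|//] := boolP (P i); rewrite negbK.
Qed.

Variable n : nat.
Implicit Types (A B T : {set 'I_n}) (j : 'I_n).

(** Symmetric difference with [{j}]; on indicator vectors it is translation by a basis vector. *)
Definition toggle j A : {set 'I_n} := [set i | (i == j) (+) (i \in A)].

Lemma toggleK j : involutive (toggle j).
Proof. by move=> A; apply/setP => i; rewrite !inE addKb. Qed.

Lemma in_toggle j A : (j \in toggle j A) = (j \notin A).
Proof. by rewrite inE eqxx. Qed.

Lemma toggle_sub j A T : j \in T -> (toggle j A \subset T) = (A \subset T).
Proof.
move=> jT; apply/subsetP/subsetP => AT i; have := AT i;
  by rewrite !inE; case: eqVneq => //= ->.
Qed.

Lemma sub_toggle j A T : j \notin T -> (T \subset toggle j A) = (T \subset A).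
Proof.
move=> jT; apply/subsetP/subsetP => TA i iT; have := TA i iT;
  by rewrite inE; case: eqVneq => // ij; rewrite -ij iT in jT.
Qed.

Lemma sum_subsetU1 (V : zmodType) (F : {set 'I_n} -> V) j T : j \notin T ->
  \sum_(A : {set 'I_n} | A \subset j |: T) F A =
  \sum_(A : {set 'I_n} | A \subset T) (F (toggle j A) + F A).
Proof.
move=> jT; have subP A : (A \subset j |: T) && (j \notin A) = (A \subset T).
  apply/andP/idP => [[/subsetP AT jA]|AT].
    by apply/subsetP => i iA; case/setU1P: (AT i iA) => // ij; rewrite -ij iA in jA.
  by rewrite (subset_trans AT) ?subsetUr //; split => //; apply: contra jT; apply: (subsetP AT).
rewrite (bigID (fun A : {set 'I_n} => j \in A)) /= big_split /=; congr (_ + _).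
  rewrite (reindex_inj (inv_inj (toggleK j))) /=; apply: eq_bigl => A.
  by rewrite in_toggle toggle_sub ?setU11 // subP.
by apply: eq_bigl => A; rewrite subP.
Qed.

Definition indicator A : bits n := \row_j (j \in A)%:R.

Lemma indicator_toggle j A :
  indicator (toggle j A) = indicator A + delta_mx 0 j.
Proof.
apply/rowP => i; rewrite !mxE inE eqxx /=.
by case: (i == j) (i \in A) => [] [] //=; rewrite ?addr0 ?add0r ?F2_addrr.
Qed.

Lemma indicator_support (a : bits n) : indicator [set j | a 0 j != 0] = a.
Proof.
by apply/rowP => j; rewrite !mxE inE; have [->|/F2_neq0->] := eqVneq (a 0 j) 0.
Qed.

Lemma sum_const_subset (V : zmodType) (c : V) T : (forall u : V, u + u = 0) ->
  T != set0 -> \sum_(A : {set 'I_n} | A \subset T) c = 0.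
Proof.
move=> V2 /set0Pn[j jT]; apply: (@sum_involution _ _ _ (fun A => j \in A) (toggle j)) => //.
- exact: toggleK.
- by move=> A; rewrite toggle_sub.
- by move=> A _; rewrite in_toggle.
Qed.

(** An interval of the subset lattice has a power of two elements, an odd number only when its ends
    coincide. This orthogonality makes subset sums their own inverse modulo 2. *)
Lemma sum_interval B T :
  \sum_(A : {set 'I_n} | (B \subset A) && (A \subset T)) 1 = (B == T)%:R :> 'F_2.
Proof.
have [->|neq] := eqVneq B T.
  by rewrite (big_pred1 T) // => A; rewrite -eqEsubset eq_sym.
have [BT|nBT] := boolP (B \subset T); last first.
  rewrite big_pred0 // => A; apply/negP => /andP[BA AT].
  by rewrite (subset_trans BA AT) in nBT.
have /subsetPn[j jT jB] : ~~ (T \subset B).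
  by apply: contra neq => TB; rewrite eqEsubset BT.
apply: (@sum_involution _ _ _ (fun A => j \in A) (toggle j)) => //.
- exact: F2_addrr.
- exact: toggleK.
- by move=> A; rewrite toggle_sub // sub_toggle.
- by move=> A _; rewrite in_toggle.
Qed.

(** The iterated difference of [f] at 0 along the basis vectors of [T], in characteristic two. The
    target [V] is general so that both bit vectors and algebra elements can be summed. *)
Definition subset_sum (V : zmodType) (f : bits n -> V) T : V :=
  \sum_(A : {set 'I_n} | A \subset T) f (indicator A).

Lemma subset_sumK (f : bits n -> 'F_2) A :
  \sum_(T : {set 'I_n} | T \subset A) subset_sum f T = f (indicator A).
Proof.
rewrite /subset_sum (exchange_big_dep (fun B => B \subset A)) /= => [|T B TA BT]; last first.
  exact: subset_trans TA.
rewrite (bigD1 A) //= [X in _ + X]big1 => [|B /andP[BA neq]].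
  rewrite addr0 (big_pred1 A) // => T.
  by rewrite -eqEsubset eq_sym.
have := sum_interval B A; rewrite (negPf neq) => e.
rewrite (eq_bigr (fun=> f (indicator B) * 1)) => [|T _]; last by rewrite mulr1.
rewrite -mulr_sumr (eq_bigl (fun T => (B \subset T) && (T \subset A))) ?e ?mulr0 //.
by move=> T; rewrite andbC.
Qed.

Definition msupport (m : 'X_{1..n}) : {set 'I_n} := [set j | m j != 0%N].

Definition multilinear_monomial T : 'X_{1..n} := [multinom (j \in T : nat) | j < n].

Lemma msupportK T : msupport (multilinear_monomial T) = T.
Proof. by apply/setP => j; rewrite inE mnmE eqb0 negbK. Qed.

Lemma multilinear_monomialK (m : 'X_{1..n}) : (forall j, (m j <= 1)%N) ->
  multilinear_monomial (msupport m) = m.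
Proof. by move=> m1; apply/mnmP => j; rewrite mnmE inE; case: (m j) (m1 j) => [|[]]. Qed.

Lemma mdeg_multilinear T : mdeg (multilinear_monomial T) = #|T|.
Proof.
by rewrite mdegE -sum1_card [RHS]big_mkcond /=; apply: eq_bigr => j _; rewrite mnmE; case: ifP.
Qed.

Lemma prod_indicator A (m : 'X_{1..n}) :
  \prod_j (indicator A 0 j) ^+ m j = (msupport m \subset A)%:R.
Proof.
have [mA|/subsetPn[j]] := boolP (msupport m \subset A).
  rewrite big1 // => j _; rewrite mxE.
  have [->|mj] := eqVneq (m j) 0%N; first by rewrite expr0.
  by rewrite (subsetP mA) ?inE // expr1n.
by rewrite inE => mj /negPf jA; rewrite (bigD1 j) //= mxE jA expr0n (negPf mj) mul0r.
Qed.

(** At the indicator of [A], a monomial is 1 exactly when its support lies in [A]. Its subset sum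
    over [T] thus counts the sets between its support and [T], and a reduced monomial is determined
    by its support. *)
Lemma subset_sum_meval (p : {mpoly 'F_2[n]}) T : reduced p ->
  subset_sum (fun a : bits n => p.@[a 0]) T = p@_(multilinear_monomial T).
Proof.
move=> p_red; rewrite [in RHS](mpolyE p) raddf_sum /= /subset_sum.
under [LHS]eq_bigr => A _ do rewrite mevalE.
rewrite exchange_big /= [LHS]big_seq [RHS]big_seq; apply: eq_bigr => m m_p.
rewrite -mulr_sumr mcoeffZ mcoeffX; congr (_ * _).
under eq_bigr => A _ do rewrite prod_indicator mulrb.
rewrite -big_mkcondr /= (eq_bigl (fun A => (msupport m \subset A) && (A \subset T))).
  rewrite sum_interval; congr (nat_of_bool _)%:R.
  apply/eqP/eqP => [<-|->]; last exact: msupportK.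
  by rewrite multilinear_monomialK //; apply: p_red.
by move=> A; rewrite andbC.
Qed.

Lemma has_monomial_subset_sum (f : bits n -> bits n) k :
  has_monomial_of_degree f k <-> exists2 T : {set 'I_n}, #|T| = k & subset_sum f T != 0.
Proof.
have coordE i T : subset_sum f T 0 i = subset_sum (fun a => f a 0 i) T.
  by rewrite /subset_sum summxE.
split=> [[p p_f [i [m m_p m_k]]]|[T Tk fT]].
  have [p_red pE] := p_f i; have m1 := p_red m m_p.
  exists (msupport m); first by rewrite -mdeg_multilinear multilinear_monomialK.
  apply: contraL m_p => /eqP/rowP/(_ i); rewrite coordE mxE => fm0.
  rewrite mcoeff_msupp negbK -(multilinear_monomialK m1) -subset_sum_meval //.
  by rewrite -fm0; apply/eqP/eq_bigr => A _; rewrite pE.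
(* The polynomial whose coefficients are the subset sums; it represents [f] by Moebius inversion. *)
pose p i : {mpoly 'F_2[n]} :=
  \sum_(A : {set 'I_n}) subset_sum f A 0 i *: 'X_[multilinear_monomial A].
have pcoef i m : (p i)@_m =
    \sum_(A : {set 'I_n}) subset_sum f A 0 i * (multilinear_monomial A == m)%:R.
  by rewrite raddf_sum; apply: eq_bigr => A _; rewrite /= mcoeffZ mcoeffX.
have pT i A : (p i)@_(multilinear_monomial A) = subset_sum f A 0 i.
  rewrite pcoef (bigD1 A) //= eqxx mulr1 big1 ?addr0 // => B neq.
  rewrite (can_eq msupportK) (negPf neq) mulr0 //.
exists p => [i|].
  split=> [m|a].
    rewrite mcoeff_msupp pcoef => m_p j; apply: contraR m_p => /negP mj.
    rewrite big1 // => A _; case: eqP => [e|]; last by rewrite mulr0.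
    by case: mj; rewrite -e mnmE leq_b1.
  rewrite -[a in RHS]indicator_support -(subset_sumK (fun a => f a 0 i)).
  rewrite raddf_sum big_mkcond /= [RHS]big_mkcond; apply: eq_bigr => A _.
  rewrite mevalZ mevalX -[a]indicator_support prod_indicator msupportK indicator_support.
  by rewrite -coordE; case: ifP; rewrite ?mulr1 ?mulr0.
have [i fTi] : exists i, subset_sum f T 0 i != 0.
  apply/existsP; apply: contraR fT; rewrite negb_exists => /forallP fT0.
  by apply/eqP/rowP => i; rewrite mxE; apply/eqP; rewrite -[_ == _]negbK.
exists i, (multilinear_monomial T); last by rewrite mdeg_multilinear.
by rewrite mcoeff_msupp pT.
Qed.

End SubsetSums.

(** * Linear independence of the coefficient vectors *)

Section LowerBound.
Import GRing.Theory.
Local Open Scope ring_scope.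

Variables (n : nat) (f : bits n -> bits n).
Variables (N : 'I_n -> bits n -> bits n) (c : 'I_n -> bits n).
Hypothesis N_add : forall j, {morph N j : x y / x + y}.
Hypothesis N_f : forall j x, f (x + delta_mx 0 j) + f x = N j (f x) + c j.

Lemma N0 j : N j 0 = 0.
Proof. by apply: (addrI (N j 0)); rewrite -N_add !addr0. Qed.

(** Applied to each term, [N j] gives a difference of [f] along [j] plus [c j]. The constants cancel
    because a nonempty set has evenly many subsets. The differences cancel if [j] is in [T], and
    otherwise run over the subsets of [j |: T]. *)
Lemma N_subset_sum j (T : {set 'I_n}) : T != set0 ->
  N j (subset_sum f T) = if j \in T then 0 else subset_sum f (j |: T).
Proof.
move=> T0; rewrite /subset_sum (big_morph _ (N_add j) (N0 j)).
rewrite (eq_bigr (fun A => f (indicator (toggle j A)) + f (indicator A) + c j)); last first.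
  by move=> A _; rewrite indicator_toggle N_f bits_addrK.
rewrite !big_split /= sum_const_subset ?addr0 //; last exact: bits_addrr.
have [jT|jT] := boolP (j \in T).
  rewrite [X in _ + X](reindex_inj (inv_inj (toggleK j))) /=.
  by under [X in _ + X]eq_bigl => A do rewrite toggle_sub //; rewrite bits_addrr.
by rewrite sum_subsetU1 // big_split.
Qed.

Definition iterN s x := foldr N x s.

Lemma iterN_cons j s x : iterN (j :: s) x = N j (iterN s x).
Proof. by []. Qed.

Lemma iterN_add s : {morph iterN s : x y / x + y}.
Proof. by elim: s => // j s IHs x y; rewrite !iterN_cons IHs N_add. Qed.

Lemma iterN0 s : iterN s 0 = 0.
Proof. by elim: s => // j s IHs; rewrite iterN_cons IHs N0. Qed.

Lemma iterN_scale s (a : 'F_2) x : iterN s (a *: x) = a *: iterN s x.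
Proof. by have [->|/F2_neq0->] := eqVneq a 0; rewrite ?scale0r ?iterN0 ?scale1r. Qed.

Lemma iterN_subset_sum s (T : {set 'I_n}) : T != set0 -> uniq s ->
  iterN s (subset_sum f T) =
  if has (mem T) s then 0 else subset_sum f ([set:: s] :|: T).
Proof.
move=> T0; elim: s => [|j s IHs]; first by rewrite set_nil set0U.
rewrite iterN_cons /=.
case/andP=> js /IHs->; case: ifP; rewrite ?orbT ?orbF ?N0 // => sT.
rewrite N_subset_sum; last by apply: contra T0; rewrite setU_eq0 => /andP[].
by rewrite !inE (negPf js) /= set_cons setUA.
Qed.

Lemma subset_sum_dimension T : subset_sum f T != 0 -> (2 ^ #|T| - 1 <= n)%N.
Proof.
move=> fT; pose P := powerset T :\ set0.
have <- : #|P| = (2 ^ #|T| - 1)%N.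
  by rewrite -card_powerset (cardsD1 set0 (powerset T)) powersetE sub0set addKn.
have Pne (i : 'I_#|P|) : enum_val i != set0 by have := enum_valP i; rewrite in_setD1 => /andP[].
have PT (i : 'I_#|P|) : enum_val i \subset T.
  by have := enum_valP i; rewrite in_setD1 powersetE => /andP[].
pose M := \matrix_(i < #|P|) subset_sum f (enum_val i).
suff /eqP <- : row_free M by exact: rank_leq_col.
apply: inj_row_free => v; rewrite mulmx_sum_row => vM0.
apply/rowP => i1; rewrite mxE; apply/eqP; apply: contraT => vi1.
(* Among the sets occurring in the relation, choose one of least cardinality. *)
case: (@arg_minnP _ i1 (fun i => v 0 i != 0) (fun i => #|enum_val i|) vi1) => i vi min_i.
(* These directions carry the chosen set to all of [T] and annihilate the term of any set that meets
   them. *)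
pose s := enum (T :\: enum_val i).
have := congr1 (iterN s) vM0; rewrite iterN0 (big_morph _ (iterN_add s) (iterN0 s)).
rewrite (bigD1 i) //= big1 => [|j ji].
  rewrite addr0 iterN_scale rowK iterN_subset_sum ?enum_uniq //.
  rewrite (F2_neq0 vi) scale1r ifF; last first.
    by apply/hasP => -[x]; rewrite mem_enum in_setD => /andP[/negP xi _] /xi.
  have -> : [set:: s] :|: enum_val i = T.
    apply/setP => x; rewrite in_setU in_set mem_enum in_setD.
    by have [xi|_] := boolP (x \in enum_val i); rewrite /= ?orbF // (subsetP (PT i)).
  by move/eqP; rewrite (negPf fT).
rewrite iterN_scale rowK iterN_subset_sum ?enum_uniq //.
have [->|vj] := eqVneq (v 0 j) 0; first by rewrite scale0r.
suff -> : has (mem (enum_val j)) s by rewrite scaler0.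
(* By minimality another set of the relation is not contained in the chosen one, so it meets [s] and
   its term vanishes. *)
have /subsetPn[x xj xi] : ~~ (enum_val j \subset enum_val i).
  apply: contra ji => sub; apply/eqP/enum_val_inj/eqP.
  by rewrite eqEcard sub min_i.
by apply/hasP; exists x; rewrite // mem_enum inE xi (subsetP (PT j)).
Qed.

End LowerBound.

Section ThirdLevelBound.
Import GRing.Theory.
Local Open Scope ring_scope.

Lemma third_level_degree_bound (R : realType) k n (pi : {perm bits n}) :
  clifford_hierarchy 3 (perm_gate R pi) -> has_monomial_of_degree pi k ->
  (2 ^ k - 1 <= n)%N.
Proof.
move=> pi3 /has_monomial_subset_sum[T <-].
pose t (j : 'I_n) x := pi (pi^-1%g x + delta_mx 0 j).
have t_aff j : affine (t j) by exact: third_level_affine pi3.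
(* At [y = pi x] the difference of [pi] along [j] is [t j y + y]; splitting off the constant [t j 0]
   leaves an additive map of [y]. *)
apply: (@subset_sum_dimension _ _ (fun j x => t j x + x + t j 0) (fun j => t j 0)).
- move=> j x y; rewrite (affineD _ _ (t_aff j) (@bits_addrr n)).
  by rewrite [LHS](AC (3*2*1) ((1*4*3)*(2*5*6))).
- by move=> j x; rewrite bits_addrK /t permK.
Qed.

End ThirdLevelBound.

(** * The extremal gate *)

(** An element of [F_2[x_1, ..., x_k] / (x_1^2, ..., x_k^2)], given by its coefficient at each
    squarefree monomial [x_S]. *)
Definition truncated_algebra (k : nat) := {ffun {set 'I_k} -> 'F_2}.

HB.instance Definition _ k := GRing.Zmodule.on (truncated_algebra k).

Section TruncatedAlgebra.
Import GRing.Theory.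
Local Open Scope ring_scope.

Variable k : nat.
Implicit Types (u v w : truncated_algebra k) (S A B : {set 'I_k}) (i s : 'I_k).

Definition trunc_monomial A : truncated_algebra k := [ffun S => (S == A)%:R].

(** Since [x_A x_B] is 0 unless [A] and [B] are disjoint, only splittings of [S] into two
    complementary parts contribute. *)
Definition trunc_mul u v : truncated_algebra k :=
  [ffun S : {set 'I_k} => \sum_(A : {set 'I_k} | A \subset S) u A * v (S :\: A)].

Fact trunc_mulC : commutative trunc_mul.
Proof.
move=> u v; apply/ffunP => S; rewrite !ffunE.
have DD A : A \subset S -> S :\: (S :\: A) = A.
  by move=> AS; rewrite setDDr setDv set0U; apply/setIidPr.
rewrite (reindex_onto (fun A => S :\: A) (fun A => S :\: A)) //=.
apply: eq_big => [A|A /andP[_ /eqP->]]; last exact: mulrC.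
rewrite subsetDl /=; apply/eqP/idP => [<-|/DD //].
exact: subsetDl.
Qed.

Fact trunc_mulA : associative trunc_mul.
Proof.
move=> u v w; apply/ffunP => S; rewrite !ffunE.
transitivity (\sum_(A : {set 'I_k} | A \subset S)
    \sum_(B : {set 'I_k} | B \subset S :\: A) u A * (v B * w (S :\: A :\: B))).
  by apply: eq_bigr => A _; rewrite ffunE mulr_sumr.
transitivity (\sum_(C : {set 'I_k} | C \subset S)
    \sum_(A : {set 'I_k} | A \subset C) u A * v (C :\: A) * w (S :\: C)); last first.
  by apply: eq_bigr => C _; rewrite ffunE mulr_suml.
rewrite [RHS](exchange_big_dep (fun A => A \subset S)) /= => [|C A CS sAC]; last first.
  exact: subset_trans CS.
apply: eq_bigr => A AS.
(* Both sides run over ordered partitions of [S] into three parts; [C] is the union of the first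
   two. *)
rewrite [RHS](reindex_onto (fun B => A :|: B) (fun C => C :\: A)) /=; last first.
  by move=> C /andP[_ sAC]; rewrite -{1}(setIidPr sAC) setID.
apply: eq_big => [B|B BSA].
  rewrite subsetUl andbT subUset AS /= setDUl setDv set0U subsetD.
  by rewrite (sameP eqP setDidPl).
have -> : (A :|: B) :\: A = B.
  by move: BSA; rewrite subsetD => /andP[_ /setDidPl]; rewrite setDUl setDv set0U.
by rewrite setDDl mulrA.
Qed.

Fact trunc_mul1 : left_id (trunc_monomial set0) trunc_mul.
Proof.
move=> u; apply/ffunP => S; rewrite !ffunE (bigD1 set0) ?sub0set //= ffunE eqxx mul1r setD0.
by rewrite big1 ?addr0 // => A /andP[_ /negPf A0]; rewrite ffunE A0 mul0r.
Qed.

Fact trunc_mulDl : left_distributive trunc_mul +%R.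
Proof.
move=> u v w; apply/ffunP => S; rewrite !ffunE -big_split /=.
by apply: eq_bigr => A _; rewrite ffunE mulrDl.
Qed.

Fact trunc_monomial0_neq0 : trunc_monomial set0 != 0.
Proof. by apply/eqP => /ffunP/(_ set0); rewrite !ffunE eqxx. Qed.

HB.instance Definition _ := GRing.Zmodule_isComNzRing.Build (truncated_algebra k)
  trunc_mulA trunc_mulC trunc_mul1 trunc_mulDl trunc_monomial0_neq0.

Lemma trunc_mulE u v S :
  (u * v) S = \sum_(A : {set 'I_k} | A \subset S) u A * v (S :\: A).
Proof. by rewrite ffunE. Qed.

Lemma trunc_1E S : (1 : truncated_algebra k) S = (S == set0)%:R.
Proof. by rewrite ffunE. Qed.

Lemma trunc_addE u v S : (u + v) S = u S + v S.
Proof. by rewrite ffunE. Qed.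

Lemma trunc_addrr u : u + u = 0.
Proof. by apply/ffunP => S; rewrite !ffunE F2_addrr. Qed.

Lemma trunc_mul_set0 u v : (u * v) set0 = u set0 * v set0.
Proof.
by rewrite trunc_mulE (big_pred1 set0) ?setD0 // => A; rewrite subset0.
Qed.

(** Squaring keeps only the square of the constant coefficient: at nonempty [S], the terms of [A]
    and of its complement in [S] are equal and cancel. *)
Lemma trunc_sqr u : u set0 = 1 -> u * u = 1.
Proof.
move=> u0; apply/ffunP => S; rewrite trunc_1E.
have [->|S0] := eqVneq S set0; first by rewrite trunc_mul_set0 u0 mulr1.
have /set0Pn[s sS] := S0; rewrite trunc_mulE.
(* Symmetric difference with [S]: it is the complement inside [S], and an involution on all sets. *)
pose flip A := [set i | (i \in S) (+) (i \in A)].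
have flipE A : A \subset S -> flip A = S :\: A.
  move=> /subsetP AS; apply/setP => i; rewrite !inE.
  by have [/AS->|] := boolP (i \in A); rewrite ?addbF.
apply: (@sum_involution _ _ _ (fun A => s \in A) flip) => [|A|A|A AS|A AS].
- exact: F2_addrr.
- by apply/setP => i; rewrite !inE addKb.
- apply/subsetP/subsetP => AS i; have := AS i; rewrite !inE;
    by case: (i \in S); case: (i \in A) => // /(_ isT).
- by rewrite inE sS.
- by rewrite flipE // setDDr setDv set0U (setIidPr AS) mulrC.
Qed.

Lemma trunc_monomial_mul A u S :
  (trunc_monomial A * u) S = if A \subset S then u (S :\: A) else 0.
Proof.
rewrite trunc_mulE; have [AS|AS] := ifP.
  rewrite (bigD1 A) //= ffunE eqxx mul1r big1 ?addr0 // => B /andP[_ /negPf BA].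
  by rewrite ffunE BA mul0r.
rewrite big1 // => B BS; rewrite ffunE; case: eqP => [e|]; last by rewrite mul0r.
by rewrite -e BS in AS.
Qed.

Lemma trunc_monomialU1 i A : i \notin A ->
  trunc_monomial A * trunc_monomial [set i] = trunc_monomial (i |: A).
Proof.
move=> iA; apply/ffunP => S; rewrite trunc_monomial_mul !ffunE.
have [->|neq] := eqVneq S (i |: A).
  by rewrite subsetUr setDUl setDv setU0 (setDidPl _) ?eqxx // disjoints1.
case: ifP => // AS; case: eqP => // e; case/eqP: neq.
by rewrite -e setUC -{1}(setIidPr AS) setID.
Qed.

(** The partial derivative in [x_s], well defined on the quotient because the derivative of [x_s^2]
    is 0 in characteristic two. *)
Definition trunc_deriv s u : truncated_algebra k :=
  [ffun S : {set 'I_k} => if s \in S then 0 else u (toggle s S)].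

Lemma trunc_derivE s u S : trunc_deriv s u S = if s \in S then 0 else u (toggle s S).
Proof. by rewrite ffunE. Qed.

Lemma trunc_derivD s u v : trunc_deriv s (u + v) = trunc_deriv s u + trunc_deriv s v.
Proof.
by apply/ffunP => S; rewrite trunc_addE !trunc_derivE trunc_addE; case: ifP; rewrite ?addr0.
Qed.

(** If [s] is not in [S], the coefficient of [u * v] at [s |: S] splits according to which factor
    receives [s]. If [s] is in [S], moving [s] between the factors pairs off equal terms on the
    right. *)
Lemma trunc_derivM s u v : trunc_deriv s (u * v) = trunc_deriv s u * v + u * trunc_deriv s v.
Proof.
apply/ffunP => S; rewrite trunc_derivE trunc_addE !trunc_mulE -big_split /=.
case: ifPn => sS.
  apply/esym/(@sum_involution _ _ _ (fun A => s \in A) (toggle s)) => [|A|A|A AS|A AS].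
  - exact: F2_addrr.
  - exact: toggleK.
  - exact: toggle_sub.
  - exact: in_toggle.
  rewrite !trunc_derivE in_toggle toggleK.
  have -> : S :\: toggle s A = toggle s (S :\: A).
    by apply/setP => i; rewrite !inE; case: eqVneq => [->|_] /=; rewrite ?sS ?andbT ?negbK.
  rewrite in_toggle in_setD sS andbT toggleK.
  by case: (s \in A); rewrite /= ?mul0r ?mulr0 addrC.
have -> : toggle s S = s |: S.
  by apply/setP => i; rewrite !inE; case: eqVneq => [->|_] //=; rewrite (negPf sS).
rewrite sum_subsetU1 //; apply: eq_bigr => A AS.
have sA : s \notin A by apply: contra sS; apply: (subsetP AS).
rewrite !trunc_derivE (negPf sA) in_setD (negPf sS) andbF.
congr (_ * v _ + _ * v _); apply/setP => i; rewrite !inE; case: eqVneq => [->|_] //=.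
- by rewrite (negPf sA) (negPf sS).
- by rewrite (negPf sS) (negPf sA).
Qed.

(* For [u] with constant coefficient 1, [u^-1 = u], so this is the logarithmic
   derivative of [u], which turns products into sums. *)
Definition dlog s u : truncated_algebra k := u * trunc_deriv s u.

Lemma dlogM s u v : u set0 = 1 -> v set0 = 1 ->
  dlog s (u * v) = dlog s u + dlog s v.
Proof.
move=> u0 v0; rewrite /dlog trunc_derivM.
set u' := trunc_deriv s u; set v' := trunc_deriv s v.
transitivity (u * u' * (v * v) + v * v' * (u * u)); first by ring.
by rewrite !trunc_sqr // !mulr1.
Qed.

(** As [dlog] is the product of two additive maps of [u], its difference along [w] is affine. *)
Lemma dlog_quadratic s w : affine (fun u => dlog s (u + w) + dlog s u).
Proof.
have E u : dlog s (u + w) + dlog s u =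
    w * trunc_deriv s u + u * trunc_deriv s w + w * trunc_deriv s w.
  rewrite /dlog trunc_derivD.
  set u' := trunc_deriv s u; set w' := trunc_deriv s w.
  transitivity (w * u' + u * w' + w * w' + (u * u' + u * u')); first by ring.
  by rewrite trunc_addrr addr0.
move=> a b c; rewrite !E !trunc_derivD.
set w' := trunc_deriv s w; set a' := trunc_deriv s a.
set b' := trunc_deriv s b; set c' := trunc_deriv s c.
(* The constant [w * w'] occurs once on the left and three times on the right, so two copies are
   added. *)
by rewrite -[LHS]addr0 -(trunc_addrr (w * w')); ring.
Qed.

End TruncatedAlgebra.

(** * The logarithm on units with constant coefficient 1 and its inverse gate *)

Section ExtremalGate.
Import GRing.Theory.
Local Open Scope ring_scope.

Variable k : nat.

(** These sets index the qubits: one for each non-constant coefficient. *)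
Definition nonempty_sets := [set S : {set 'I_k} | S != set0].
Local Notation n := #|nonempty_sets|.
Local Notation algebra := (truncated_algebra k).

Lemma nonempty_enum (j : 'I_n) : enum_val j != set0.
Proof. by have := enum_valP j; rewrite inE. Qed.

Lemma enum_nonempty (S : {set 'I_k}) : S != set0 -> exists j : 'I_n, enum_val j = S.
Proof.
move=> S0; have SP : S \in nonempty_sets by rewrite inE.
by exists (enum_rank_in SP S); rewrite enum_rankK_in.
Qed.

Definition to_unit (x : bits n) : algebra :=
  [ffun S : {set 'I_k} => (S == set0)%:R + \sum_(j < n) x 0 j * (S == enum_val j)%:R].

Definition of_unit (u : algebra) : bits n := \row_j u (enum_val j).

Lemma to_unit_set0 x : to_unit x set0 = 1.
Proof.
rewrite ffunE eqxx big1 ?addr0 // => j _.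
by rewrite eq_sym (negPf (nonempty_enum j)) mulr0.
Qed.

Lemma to_unitE x j : to_unit x (enum_val j) = x 0 j.
Proof.
rewrite ffunE (negPf (nonempty_enum j)) add0r (bigD1 j) //= eqxx mulr1 big1 ?addr0 //.
by move=> i ij; rewrite (inj_eq enum_val_inj) eq_sym (negPf ij) mulr0.
Qed.

Lemma to_unitK : cancel to_unit of_unit.
Proof. by move=> x; apply/rowP => j; rewrite mxE to_unitE. Qed.

Lemma of_unitK (u : algebra) : u set0 = 1 -> to_unit (of_unit u) = u.
Proof.
move=> u0; apply/ffunP => S; have [->|S0] := eqVneq S set0; first by rewrite to_unit_set0.
by have [j <-] := enum_nonempty S0; rewrite to_unitE mxE.
Qed.

Lemma to_unit_inj : injective to_unit.
Proof. exact: can_inj to_unitK. Qed.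

Lemma to_unit_affine : affine to_unit.
Proof.
move=> x y z; apply/ffunP => S; rewrite !trunc_addE.
have [->|S0] := eqVneq S set0; first by rewrite !to_unit_set0 F2_addrr add0r.
by have [j <-] := enum_nonempty S0; rewrite !to_unitE !mxE.
Qed.

Lemma to_unit0 : to_unit 0 = 1.
Proof.
apply/ffunP => S; rewrite !ffunE big1 ?addr0 // => j _.
by rewrite mxE mul0r.
Qed.

Lemma to_unitD x y : to_unit (x + y) = to_unit x + to_unit y + 1.
Proof. by rewrite (affineD _ _ to_unit_affine (@trunc_addrr k)) to_unit0. Qed.

Lemma to_unit_sqr x : to_unit x * to_unit x = 1.
Proof. by rewrite trunc_sqr // to_unit_set0. Qed.

Definition circle (x y : bits n) : bits n := of_unit (to_unit x * to_unit y).

Lemma to_unit_circle x y : to_unit (circle x y) = to_unit x * to_unit y.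
Proof. by rewrite of_unitK // trunc_mul_set0 !to_unit_set0 mulr1. Qed.

Lemma circle_affine y : affine (circle^~ y).
Proof.
move=> a b c; rewrite /circle to_unit_affine !mulrDl.
by apply/rowP => j; rewrite !mxE !trunc_addE.
Qed.

Variable pivot : 'I_n -> 'I_k.
Hypothesis pivotP : forall j, pivot j \in enum_val j.

Definition log_bits (x : bits n) : bits n :=
  \row_j dlog (pivot j) (to_unit x) (enum_val j :\ pivot j).

Lemma log_circle x y : log_bits (circle x y) = log_bits x + log_bits y.
Proof.
apply/rowP => j; rewrite !mxE -trunc_addE to_unit_circle.
by rewrite dlogM ?to_unit_set0.
Qed.

Lemma log0 : log_bits 0 = 0.
Proof.
have e : circle 0 0 = 0 by apply: to_unit_inj; rewrite to_unit_circle to_unit0 mulr1.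
by rewrite -[in LHS]e log_circle bits_addrr.
Qed.

(** Induction on the size of the index set [S]: the logarithm coordinate is the coefficient of the
    unit at [S] plus products having as a factor its coefficient at a smaller nonempty set, already
    known to vanish. *)
Lemma log_eq0 x : log_bits x = 0 -> x = 0.
Proof.
move=> x0; suff ux (j : 'I_n) : x 0 j = 0 by apply/rowP => j; rewrite mxE.
have [m] := ubnP #|enum_val j|; elim: m j => // m IHm j /ltnSE le_m.
have /rowP/(_ j) := x0; rewrite !mxE trunc_mulE (bigD1 set0) ?sub0set //= big1.
  rewrite to_unit_set0 mul1r addr0 setD0 trunc_derivE setD11.
  have -> : toggle (pivot j) (enum_val j :\ pivot j) = enum_val j.
    by apply/setP => i; rewrite !inE; case: eqVneq => //= ->; rewrite pivotP.
  by rewrite to_unitE.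
move=> A /andP[/subsetP Asub A0]; have [i iA] := enum_nonempty A0.
rewrite -iA to_unitE IHm ?mul0r // (leq_trans _ le_m) // iA.
apply: proper_card; apply/properP; split.
  by apply/subsetP => s /Asub; rewrite inE => /andP[].
by exists (pivot j) => //; apply/negP => /Asub; rewrite setD11.
Qed.

Lemma log_inj : injective log_bits.
Proof.
move=> x y xy; apply: to_unit_inj.
(* Each unit is its own inverse, so [circle x y] is the quotient of [x] by [y]. *)
have : log_bits (circle x y) = 0 by rewrite log_circle xy bits_addrr.
move/log_eq0 => /(congr1 to_unit); rewrite to_unit_circle to_unit0 => uv.
by rewrite -[LHS]mulr1 -(to_unit_sqr y) mulrA uv mul1r.
Qed.

Lemma log_quadratic v : affine (fun x => log_bits (x + v) + log_bits x).
Proof.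
move=> x y z; apply/rowP => j; rewrite !mxE -!trunc_addE.
(* Translating the bits by [v] adds the fixed element [to_unit v + 1] to the unit. *)
rewrite !(to_unitD _ v) -!(addrA _ (to_unit v)) to_unit_affine.
by have /= -> := dlog_quadratic (pivot j) (to_unit v + 1) (to_unit x) (to_unit y) (to_unit z).
Qed.

Definition extremal_gate : {perm bits n} := (perm log_inj)^-1%g.

Lemma extremal_gateV x : extremal_gate^-1%g x = log_bits x.
Proof. by rewrite invgK permE. Qed.

Lemma logK x : extremal_gate (log_bits x) = x.
Proof. by rewrite -extremal_gateV permKV. Qed.

Lemma extremal_gateK x : log_bits (extremal_gate x) = x.
Proof. by rewrite -extremal_gateV permK. Qed.

Lemma extremal_gateD x y : extremal_gate (x + y) = circle (extremal_gate x) (extremal_gate y).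
Proof. by rewrite -[RHS]logK log_circle !extremal_gateK. Qed.

Lemma extremal_gate_third_level (R : realType) :
  clifford_hierarchy 3 (perm_gate R extremal_gate).
Proof.
apply: third_level_criterion => v x y z; last by rewrite !extremal_gateV log_quadratic.
by rewrite !extremal_gateD !permKV circle_affine.
Qed.

(** For [u = 1 + x_i] the derivative in [x_s] is 1 if [s = i] and 0 otherwise, so [dlog i u = u]. A
    set [S] with pivot [i] reads its coefficient at [S] without [i], which is 1 only for
    [S = {i}]. *)
Lemma log_singleton (i : 'I_k) (j : 'I_n) : enum_val j = [set i] ->
  log_bits (delta_mx 0 j) = delta_mx 0 j.
Proof.
move=> ji; set u := to_unit (delta_mx 0 j).
have uE : u = 1 + trunc_monomial [set i].
  apply/ffunP => S; rewrite !ffunE; congr (_ + _); rewrite (bigD1 j) //= big1.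
    by rewrite addr0 mxE !eqxx mul1r ji.
  by move=> l /negPf lj; rewrite mxE lj andbF mul0r.
have du s : trunc_deriv s u = (s == i)%:R.
  apply/ffunP => S; rewrite trunc_derivE uE trunc_addE trunc_1E ffunE.
  have -> : ((s == i)%:R : algebra) S = ((s == i) && (S == set0))%:R :> 'F_2.
    by case: (s == i); rewrite ?trunc_1E ?ffunE.
  have [sS|sS] := ifPn.
    by case: (S =P set0) => [S0|_]; [rewrite S0 inE in sS | rewrite andbF].
  have -> : (toggle s S == set0) = false.
    by apply/eqP => /setP/(_ s); rewrite in_toggle inE sS.
  rewrite add0r; congr (nat_of_bool _)%:R.
  apply/eqP/andP => [e|[/eqP-> /eqP->]]; last first.
    by apply/setP => l; rewrite !inE addbF.
  have si : s == i by have /setP/(_ s) := e; rewrite in_toggle sS inE => <-.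
  split=> //; apply/eqP/setP => l; have /setP/(_ l) := e; rewrite !inE -(eqP si).
  by case: eqVneq => [->|] //=; rewrite (negPf sS).
apply/rowP => l; rewrite !mxE /dlog -/u du eqxx /=.
have [->|lj] := eqVneq l j.
  have := pivotP j; rewrite ji inE => si.
  by rewrite si mulr1 (eqP si) setDv to_unit_set0.
have [si|_] := eqVneq (pivot l) i; last by rewrite mulr0 ffunE.
rewrite mulr1 si uE trunc_addE trunc_1E ffunE.
have -> : (enum_val l :\ i == [set i]) = false.
  by apply/eqP => /setP/(_ i); rewrite !inE eqxx.
rewrite addr0; case: eqP => // li; case/eqP: lj; apply: enum_val_inj.
rewrite ji -(setD1K (_ : i \in enum_val l)) ?li ?setU0 //.
by rewrite -si pivotP.
Qed.

Lemma to_unit_singleton (i : 'I_k) (j : 'I_n) : enum_val j = [set i] ->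
  to_unit (extremal_gate (delta_mx 0 j)) + 1 = trunc_monomial [set i].
Proof.
move=> ji; rewrite -(log_singleton ji) logK.
apply/ffunP => S; rewrite !ffunE (bigD1 j) //= big1.
  by rewrite addr0 mxE !eqxx mul1r ji addrAC F2_addrr add0r.
by move=> l /negPf lj; rewrite mxE lj andbF mul0r.
Qed.

Lemma extremal_gate_monomial : (0 < k)%N -> has_monomial_of_degree extremal_gate k.
Proof.
move=> k0; apply/has_monomial_subset_sum.
have sing i : exists j : 'I_n, enum_val j = [set i].
  by apply: enum_nonempty; apply/set0Pn; exists i; rewrite inE.
have [f fE] := fin_all_exists sing.
have f_inj : injective f by move=> i j ij; apply: set1_inj; rewrite -!fE ij.
pose g x := to_unit (extremal_gate x).
have gD x y : g (x + y) = g x * g y by rewrite /g extremal_gateD to_unit_circle.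
(* Since [g] is multiplicative, the subset sum factors as the product of the [g e_i + 1 = x_i]. *)
have sumE s : uniq s -> subset_sum g (f @: [set:: s]) = trunc_monomial [set:: s].
  elim: s => [_|i s IHs /= /andP[iS s_uniq]].
    rewrite set_nil imset0 /subset_sum (big_pred1 set0) => [|A]; last by rewrite subset0.
    rewrite (_ : indicator set0 = 0); first by rewrite /g -[in X in to_unit X]log0 logK to_unit0.
    by apply/rowP => j; rewrite !mxE inE.
  have iS' : i \notin [set:: s] by rewrite inE.
  rewrite set_cons imsetU1 /subset_sum sum_subsetU1; last by rewrite mem_imset.
  rewrite -trunc_monomialU1 // -IHs // /subset_sum mulr_suml; apply: eq_bigr => A _.
  by rewrite indicator_toggle gD -(to_unit_singleton (fE i)) mulrDr mulr1.
exists (f @: [set: 'I_k]); first by rewrite card_imset // cardsT card_ord.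
(* The degree [k] monomial is found in the coordinate indexed by the full set, where [x_1 ... x_k]
   has coefficient 1. *)
have /enum_nonempty[j jE] : [set: 'I_k] != set0.
  by apply/set0Pn; exists (Ordinal k0); rewrite inE.
apply/eqP => /rowP/(_ j); rewrite summxE mxE => /eqP.
have := sumE _ (enum_uniq 'I_k); have -> : [set:: enum 'I_k] = setT.
  by apply/setP => i; rewrite !inE mem_enum.
move/ffunP/(_ setT); rewrite ffunE eqxx /subset_sum sum_ffunE => e.
rewrite (eq_bigr (fun A => g (indicator A) setT)) ?e ?oner_eq0 // => A _.
by rewrite -jE to_unitE.
Qed.

End ExtremalGate.

Lemma extremal_gate_exists (R : realType) (k : nat) : (0 < k)%N ->
  exists pi : {perm bits (2 ^ k - 1)},
    clifford_hierarchy 3 (perm_gate R pi) /\ has_monomial_of_degree pi k.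
Proof.
move=> k0; have <- : #|nonempty_sets k| = (2 ^ k - 1)%N.
  have -> : nonempty_sets k = powerset setT :\ set0.
    by apply/setP => S; rewrite !inE subsetT andbT.
  have := cardsD1 set0 (powerset [set: 'I_k]).
  by rewrite card_powerset cardsT card_ord powersetE sub0set => ->; rewrite addKn.
have piv (j : 'I_#|nonempty_sets k|) : exists i, i \in enum_val j.
  by apply/set0Pn/nonempty_enum.
have [p pP] := fin_all_exists piv.
exists (extremal_gate pP); split; first exact: extremal_gate_third_level.
exact: extremal_gate_monomial.
Qed.

Theorem theorem5p9 (R : realType) :
  (forall (k n : nat) (pi : {perm bits n}),
     clifford_hierarchy 3 (perm_gate R pi) ->
     has_monomial_of_degree pi k ->
     (2 ^ k - 1 <= n)%N) /\
  (forall k : nat, (3 <= k)%N ->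
     exists pi : {perm bits (2 ^ k - 1)},
       clifford_hierarchy 3 (perm_gate R pi) /\
       has_monomial_of_degree pi k).
Proof.
split=> [k n pi|k k3]; first exact: third_level_degree_bound.
by apply: extremal_gate_exists; apply: leq_trans k3.
Qed.
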